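(* Let $\varepsilon>0$. Then there is a constant $c_\varepsilon>0$, depending only on $\varepsilon$, such that for every finite set $A\subseteq\mathbb{N}$ with $k=|A|\ge 2$ and every integer $n\ge k^{2+\varepsilon}$, $$|A\ast[n]|\ge c_\varepsilon\,\frac{kn}{\log k}.$$
   Context: $\mathbb{N}=\{1,2,3,\dots\}$ and $[n]=\{1,2,\dots,n\}$. For finite $A,B\subseteq\mathbb{N}$, $A\ast B$ is the set of $x\in\mathbb{N}$ for which the number of pairs $(a,b)\in A\times B$ with $ab=x$ is odd. *)

(* Defs.v *)
From mathcomp Require Import all_boot finmap.

Set Implicit Arguments.
Unset Strict Implicit.
Unset Printing Implicit Defensive.

Local Open Scope nat_scope.
Local Open Scope fset_scope.

(* MathComp's nat contains 0; sets of positive integers are represented by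
   A : {fset nat} together with the hypothesis positive_fset A. *)
Definition positive_fset (A : {fset nat}) : Prop :=
  forall a : nat, a \in A -> 0 < a.

Definition initial_segment (n : nat) : {fset nat} :=
  [fset i in iota 1 n].

Definition repr_count (A B : {fset nat}) (x : nat) : nat :=
  #|` [fset p in A `*` B | p.1 * p.2 == x] |.

(* Restricting x to the product set only serves to obtain a finite set: an odd
   number of representations is a nonzero number, see in_odd_product. *)
Definition odd_product (A B : {fset nat}) : {fset nat} :=
  [fset x in [fset p.1 * p.2 | p in A `*` B] | odd (repr_count A B x)].

Lemma in_initial_segment (n x : nat) :
  (x \in initial_segment n) = (1 <= x <= n).
Proof. by rewrite inE mem_iota add1n ltnS. Qed.

Lemma in_odd_product (A B : {fset nat}) (x : nat) :
  (x \in odd_product A B) = odd (repr_count A B x).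
Proof.
rewrite !inE /=; case: (boolP (odd _)) => [odd_x|_]; last by rewrite andbF.
rewrite andbT.
have /fset0Pn[p] : [fset p in A `*` B | p.1 * p.2 == x] != fset0.
  by apply: contraTneq odd_x; rewrite /repr_count => ->; rewrite cardfs0.
by rewrite !inE /= => /andP[pAB /eqP <-]; apply/imfsetP; exists p; rewrite //= inE.
Qed.

(* Main.v *)
Require Import Defs.
From mathcomp Require Import all_boot all_order all_algebra finmap.
From mathcomp Require Import reals exp.
From mathcomp Require Import zify ring lra.

(** Call an integer z-rough if all its prime factors exceed z, and z-smooth if
none does.  Let k be the cardinal of A and let B be the set of z-rough
integers in the half-open interval ]n/2, n], where z is about k^(1 + d) for a
small constant d > 0.  Almost all products a b with a in A and b in B are
represented only once, hence an odd number of times.  Indeed, let a b = a' b'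
and r = a' / gcd(a, a').  Then r divides b.  If r = 1, then b' is a multiple of b
not exceeding n, and b > n/2 forces b' = b.  Otherwise r is a divisor greater
than 1 of a rough number, so r > z; for given a and a' at most n/z integers b
are multiples of r, so that at most k^2 n/z pairs are lost
([card_odd_product_ge]).  It remains to find about n / log z elements in B
([rough_upper_half_ge]); with z >> k log k the loss is then negligible, and
log z is of the order of log k.

To produce elements of B, multiply a z-rough integer m <= sqrt n / 2 by a
prime p in ]n/(2m), n/m].  Such a p exceeds both m and z, so the product is
rough and determines the pair.  By Chebyshev's bound for the primes of
]h, 2h] ([chebyshev_upper_half], proved as in Erdos' proof of Bertrand's
postulate) there are at least a constant times n / (m log n) choices of p, and
the point is that the sum of 1/m over these m is at least a constant times
log n / log z ([rough_sum_ge]).  Every positive integer is the product of a smooth and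
a rough one, so this sum times the sum S of 1/s over smooth s is at least a
harmonic sum, of size log n; one needs S = O(log z).

This last bound avoids Euler products ([smooth_sum_le]).  Expanding log s over
the prime factors of s, and using that the sum of (log p)/p over p <= z is
O(log z) ([mertens_upper], from z! <= z^z), one finds that log s has mean
O(log z) for the weight 1/s on smooth numbers.  By Markov's inequality at least
half of S comes from the integers s <= z^C for some constant C, whose total weight is
O(log z).

The exponent 2 + eps is what leaves room for 4 z^2 <= n with such a z
([sieving_level]).  Bounded n are settled by the product of n and the maximum
of A, which has a single representation. *)

Set Implicit Arguments.
Unset Strict Implicit.
Unset Printing Implicit Defensive.

Import Order.TTheory GRing.Theory Num.Theory.

Local Open Scope fset_scope.
Local Open Scope nat_scope.

(** * Products with few representations *)

(** As a set of primes: [(upto z).-nat] is z-smoothness and [(upto z)^'.-nat]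
is z-roughness. *)
Definition upto (z : nat) : nat_pred := [pred p | p <= z].

Definition rough_upper_half (z n : nat) : {fset nat} :=
  [fset b in iota 1 n | (n < b.*2) && (upto z)^'.-nat b].

Lemma in_rough_upper_half (z n b : nat) :
  (b \in rough_upper_half z n) = [&& b <= n, n < b.*2 & (upto z)^'.-nat b].
Proof.
rewrite !inE /= mem_iota add1n ltnS.
by case: b => [|b] //; rewrite ltn0 andbF.
Qed.

Lemma rough_gt (z r : nat) : (upto z)^'.-nat r -> 1 < r -> z < r.
Proof.
move=> /pnatP rough_r r_gt1; apply: leq_trans (pdiv_leq (ltnW r_gt1)).
have := rough_r (ltnW r_gt1) _ (pdiv_prime r_gt1) (pdiv_dvd r).
by rewrite !inE -ltnNge.
Qed.

(** The pairs (a, b) such that b is a multiple t r of r = a' / gcd(a, a') for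
some a' in A and some t <= n / z.  Writing them as the image of the triples
(a, a', t) gives their number at once. *)
Definition collision_pairs (A : {fset nat}) (n z : nat) : {fset nat * nat} :=
  [fset (t.1.1, t.2 * (t.1.2 %/ gcdn t.1.1 t.1.2))
     | t in (A `*` A) `*` initial_segment (n %/ z)].

Lemma card_initial_segment (n : nat) : #|` initial_segment n| = n.
Proof. by rewrite /initial_segment card_fseq undup_id ?iota_uniq // size_iota. Qed.

Lemma cardfsM (K K' : choiceType) (A : {fset K}) (B : {fset K'}) :
  #|` A `*` B| = #|` A| * #|` B|.
Proof.
rewrite -(size_allpairs pair); apply: perm_size; apply: uniq_perm => //.
  by apply: allpairs_uniq => // -[a b] [a' b'] _ _.
move=> [a b]; rewrite inE; apply/andP/allpairsP => [[aA bB]|[[a' b'] [aA bB [-> ->]]]] //.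
by exists (a, b).
Qed.

Lemma card_collision_pairs (A : {fset nat}) (n z : nat) :
  #|` collision_pairs A n z| <= #|` A| * #|` A| * (n %/ z).
Proof.
apply: leq_trans (leq_imfset_card _ _ _) _.
rewrite -[size _]/#|` (A `*` A) `*` initial_segment (n %/ z)|.
by rewrite !cardfsM card_initial_segment.
Qed.

(** The cofactors r = a' / gcd(a, a') and s = a / gcd(a, a') satisfy
r b' = s b, so r divides b.  Either r > 1, and then r > z by roughness, which
makes (a, b) a collision pair; or r = 1, and then b' = s b <= n < 2 b. *)
Lemma unique_representation (A : {fset nat}) (n z a b a' b' : nat) :
  0 < a -> 0 < a' -> 0 < z -> a \in A -> a' \in A -> 0 < b' <= n ->
  b \in rough_upper_half z n -> (a, b) \notin collision_pairs A n z ->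
  a' * b' = a * b -> (a', b') = (a, b).
Proof.
move=> a_gt0 a'_gt0 z_gt0 aA a'A /andP[b'_gt0 le_b'].
rewrite in_rough_upper_half => /and3P[le_b lt_b rough_b] no_coll eq_ab.
set g := gcdn a a'.
have g_gt0 : 0 < g by rewrite gcdn_gt0 a_gt0.
pose r := a' %/ g; pose s := a %/ g.
have eq_r : a' = r * g by rewrite divnK ?dvdn_gcdr.
have eq_s : a = s * g by rewrite divnK ?dvdn_gcdl.
have r_gt0 : 0 < r by move: a'_gt0; rewrite eq_r muln_gt0 => /andP[].
have s_gt0 : 0 < s by move: a_gt0; rewrite eq_s muln_gt0 => /andP[].
have co_rs : coprime r s.
  by rewrite coprime_sym /coprime -(eqn_pmul2r g_gt0) muln_gcdl -eq_r -eq_s mul1n.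
have eq_rs : r * b' = s * b.
  apply/eqP; rewrite -(eqn_pmul2r g_gt0); apply/eqP.
  by rewrite mulnAC -eq_r eq_ab {1}eq_s mulnAC.
have r_dvd : r %| b by rewrite -(Gauss_dvdr _ co_rs) -eq_rs dvdn_mulr.
case: (ltngtP r 1) => [|r_gt1|r1]; first by case: (r) r_gt0.
  have lt_zr : z < r by apply: rough_gt r_gt1; apply: pnat_dvd rough_b.
  case/negP: no_coll; apply/imfsetP; exists ((a, a'), b %/ r) => /=; last first.
    by rewrite -/g -/r divnK.
  rewrite !in_fsetM /= aA a'A in_initial_segment /= divn_gt0 //.
  have b_gt0 : 0 < b by case/andP: rough_b.
  rewrite dvdn_leq //= leq_divRL //.
  apply: leq_trans le_b; rewrite -[X in _ <= X](divnK r_dvd).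
  by rewrite leq_mul2l ltnW ?orbT.
have s1 : s = 1.
  by case: (s) s_gt0 eq_rs => [|[|s']] // _; rewrite r1 mul1n; lia.
move: eq_rs; rewrite r1 s1 !mul1n => ->.
by rewrite eq_r eq_s r1 s1.
Qed.

(** Outside the collision pairs, every product a b has a single representation:
multiplication is injective there, and its values lie in the odd product. *)
Lemma card_odd_product_ge (A : {fset nat}) (n z : nat) :
  positive_fset A -> 0 < z ->
  #|` A| * #|` rough_upper_half z n|
    <= #|` odd_product A (initial_segment n)| + #|` A| * #|` A| * (n %/ z).
Proof.
move=> pos_A z_gt0; set B := rough_upper_half z n.
pose G := (A `*` B) `\` collision_pairs A n z.
have in_G p : p \in G ->
    [/\ p.1 \in A, p.2 \in B & (p.1, p.2) \notin collision_pairs A n z].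
  by case: p => a b; rewrite !inE /= => /and3P[].
have sub_B b : b \in B -> b \in initial_segment n.
  by rewrite in_rough_upper_half in_initial_segment => /and3P[-> _ /andP[-> _]].
have uniq_G p q : p \in G -> q \in A `*` initial_segment n ->
    q.1 * q.2 = p.1 * p.2 -> q = p.
  move=> /in_G[p1A p2B no_coll]; case: p p1A p2B no_coll => a b /= aA bB no_coll.
  rewrite in_fsetM in_initial_segment => /andP[q1A q2n] eq_q.
  rewrite [q]surjective_pairing.
  by rewrite (unique_representation _ _ z_gt0 aA q1A q2n bB) // pos_A.
have G_sub p : p \in G -> p \in A `*` initial_segment n.
  by move=> /in_G[p1A p2B _]; rewrite in_fsetM p1A sub_B.
have le_G : #|` G| <= #|` odd_product A (initial_segment n)|.
  have <- : #|` [fset p.1 * p.2 | p in G]| = #|` G|.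
    by apply: card_in_imfset => p q pG qG /= eq_pq; apply: uniq_G => //; apply: G_sub.
  apply: fsubset_leq_card; apply/fsubsetP => x /imfsetP[p pG ->] /=.
  rewrite in_odd_product /repr_count.
  have -> : [fset q in A `*` initial_segment n | q.1 * q.2 == p.1 * p.2] = [fset p].
    apply/fsetP => q; rewrite in_fset1 inE /=; apply/andP/eqP => [[q_in /eqP]|->].
      by apply: uniq_G.
    by rewrite eqxx; split; first exact: G_sub.
  by rewrite cardfs1.
rewrite -cardfsM -(cardfsID (collision_pairs A n z)) addnC leq_add //.
apply: leq_trans (card_collision_pairs A n z).
exact: fsubset_leq_card (fsubsetIr _ _).
Qed.

(** The largest product, of max A and n, can be written in one way only. *)
Lemma odd_product_nonempty (A : {fset nat}) (n : nat) :
  positive_fset A -> 0 < #|` A| -> 0 < n ->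
  0 < #|` odd_product A (initial_segment n)|.
Proof.
move=> pos_A A_gt0 n_gt0.
have exA : exists a, a \in A by apply/fset0Pn; rewrite -cardfs_gt0.
have ubA a : a \in A -> a <= \max_(i <- A) i by move=> aA; exact: leq_bigmax_seq.
case: (ex_maxnP exA ubA) => a aA max_a.
rewrite cardfs_gt0; apply/fset0Pn; exists (a * n).
rewrite in_odd_product /repr_count.
have -> : [fset q in A `*` initial_segment n | q.1 * q.2 == a * n] = [fset (a, n)].
  apply/fsetP => -[a' b']; rewrite in_fset1 !inE /= mem_iota add1n ltnS.
  apply/andP/eqP => [[/and3P[a'A b'_gt0 le_b'] /eqP eq_an]|[-> ->]]; last first.
    by rewrite aA n_gt0 leqnn.
  have le_a' := max_a _ a'A; have a_gt0 := pos_A _ aA.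
  have eq_b : b' = n.
    apply/eqP; rewrite eqn_leq le_b' -(leq_pmul2l a_gt0) -eq_an.
    by rewrite leq_mul2r le_a' orbT.
  by congr (_, _) => //; apply/eqP; rewrite -(eqn_pmul2r n_gt0) -{1}eq_b eq_an.
by rewrite cardfs1.
Qed.

(** * Binomial coefficients and products of primes *)

Lemma prod_prime_powers (N s : nat) :
  0 < s -> (forall p, prime p -> p %| s -> p <= N) ->
  s = \prod_(p < N.+1 | prime p) p ^ logn p s.
Proof.
move=> s_gt0 le_N.
rewrite -(big_mkord prime (fun p => p ^ logn p s)).
rewrite {1}(prod_prime_decomp s_gt0) prime_decompE big_map /=.
rewrite [RHS](bigID (mem (primes s))) /= [X in _ = _ * X]big1 ?muln1; last first.
  move=> p /andP[_]; rewrite -logn_gt0 lt0n negbK => /eqP->.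
  by rewrite expn0.
rewrite -[RHS]big_filter; apply: perm_big; apply: uniq_perm.
- exact: primes_uniq.
- by rewrite filter_uniq ?iota_uniq.
move=> p; rewrite mem_filter mem_index_iota /=.
case: (boolP (p \in primes s)) => [|_]; rewrite ?andbF //.
rewrite mem_primes => /and3P[pr_p _ p_dvd]; rewrite pr_p ltnS.
by rewrite le_N.
Qed.

(** Distinct primes are coprime, so their product divides what each of them
divides. *)
Lemma prod_primes_dvd (P : pred nat) (N s : nat) :
  (forall p, p < N -> P p -> prime p /\ p %| s) -> \prod_(p < N | P p) p %| s.
Proof.
elim: N => [|N IHN] dvd_s; first by rewrite big_ord0 dvd1n.
rewrite big_mkcond big_ord_recr /= -big_mkcond /=.
have IH : \prod_(p < N | P p) p %| s.
  by apply: IHN => p lt_pN; apply: dvd_s; apply: ltnW.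
case: ifP => [PN|_]; last by rewrite muln1.
have [pr_N N_dvd] := dvd_s N (ltnSn N) PN.
rewrite Gauss_dvd ?IH //.
rewrite coprime_sym prime_coprime // Euclid_dvd_prod //.
apply/negP; rewrite big_has_cond => /hasP[i _ /andP[Pi]].
have [pr_i _] := dvd_s i (ltnW (ltn_ord i)) Pi.
by rewrite dvdn_prime2 // => /eqP eq_Ni; have := ltn_ord i; rewrite -eq_Ni ltnn.
Qed.

Lemma prime_dvd_fact (p m : nat) : prime p -> (p %| m`!) = (p <= m).
Proof.
move=> pr_p; apply/idP/idP => [|le_pm]; last by rewrite dvdn_fact ?prime_gt0.
elim: m => [|m IHm]; first by rewrite fact0 Euclid_dvd1.
rewrite factS Euclid_dvdM // => /orP[/dvdn_leq->//|/IHm]; exact: leqW.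
Qed.

(** Such a p occurs in the numerator of (a + b)! / (a! b!) only. *)
Lemma prime_dvd_bin_mid (a b p : nat) :
  prime p -> a < p -> b < p -> p <= a + b -> p %| 'C(a + b, a).
Proof.
move=> pr_p lt_ap lt_bp le_pn.
have : p %| (a + b)`! by rewrite prime_dvd_fact.
rewrite -(bin_fact (leq_addr b a)) addKn !Euclid_dvdM // !prime_dvd_fact //.
by rewrite (leqNgt p a) (leqNgt p b) lt_ap lt_bp !orbF.
Qed.

(** The row 2m + 1 of Pascal's triangle sums to 2 * 4^m and contains this
coefficient twice. *)
Lemma bin_odd_le (m : nat) : 'C(m.*2.+1, m) <= 4 ^ m.
Proof.
have sum_le : 'C(m.*2.+1, m) + 'C(m.*2.+1, m.+1) <= 2 ^ m.*2.+1.
  have lt_m : m < m.*2.+2 by lia.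
  have lt_Sm : m.+1 < m.*2.+2 by lia.
  have -> : 2 ^ m.*2.+1 = \sum_(i < m.*2.+2) 'C(m.*2.+1, i).
    by rewrite -[2]/(1 + 1) expnDn; apply: eq_bigr => i _; rewrite !exp1n !muln1.
  rewrite (bigD1 (Ordinal lt_m)) //= (bigD1 (Ordinal lt_Sm)) /=; last first.
    by rewrite -val_eqE /= neq_ltn ltnSn orbT.
  by rewrite addnA leq_addr.
have eq_bin : 'C(m.*2.+1, m.+1) = 'C(m.*2.+1, m).
  rewrite -(bin_sub (m := m)); last by lia.
  by congr 'C(_, _); lia.
by move: sum_le; rewrite eq_bin addnn -mul2n expnS leq_pmul2l // -mul2n expnM.
Qed.

(** For n = 2m + 1, the primes in ]m + 1, 2m + 1] divide the binomial
coefficient of [bin_odd_le], which is at most 4^m, and the primes up to m + 1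
are covered by induction. *)
Lemma primorial_le (n : nat) : \prod_(p < n.+1 | prime p) p <= 4 ^ n.
Proof.
elim/ltn_ind: n => -[|[|[|n]]] IHn.
- by rewrite big_mkcond /= big_ord_recr big_ord0.
- by rewrite big_mkcond /= !big_ord_recr big_ord0.
- by rewrite big_mkcond /= !big_ord_recr big_ord0.
case: (boolP (odd n)) => odd_n.
  rewrite big_mkcond big_ord_recr /= -big_mkcond /= ifF ?muln1; last first.
    apply/negP => pr_n; have := even_prime pr_n; lia.
  by apply: leq_trans (IHn n.+2 _) _ => //; rewrite leq_exp2l.
have eq_n : n.+3 = n./2.+1.*2.+1 by have := odd_double_half n; lia.
rewrite eq_n; set m := n./2.+1 in eq_n *.
rewrite -(big_mkord prime id) (big_cat_nat (n := m.+2)) //=; last by lia.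
rewrite big_mkord -addnn -addnS expnD mulnC leq_mul //.
  apply: leq_trans (bin_odd_le m); apply: dvdn_leq; first by rewrite bin_gt0; lia.
  rewrite addnS addnn.
  have -> : \prod_(m.+2 <= p < m.*2.+2 | prime p) p =
      \prod_(p < m.*2.+2 | (m.+2 <= p) && prime p) p.
    rewrite -(big_mkord (fun p => (m.+2 <= p) && prime p) id).
    rewrite [RHS](big_cat_nat (n := m.+2)) //=; last by lia.
    rewrite [X in X * _]big_nat_cond [X in X * _]big1 ?mul1n; last first.
      by move=> i /andP[/andP[_ lt_i] /andP[le_i _]]; lia.
    rewrite [LHS]big_nat_cond [RHS]big_nat_cond; apply: eq_bigl => i.
    by case: (m.+2 <= i).
  apply: (@prod_primes_dvd (fun p => (m.+2 <= p) && prime p)) => p lt_p /andP[le_p pr_p]; split => //.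
  have -> : m.*2.+1 = m + m.+1 by lia.
  by apply: prime_dvd_bin_mid => //; lia.
by apply: IHn; lia.
Qed.

Lemma central_bin_rec (m : nat) :
  m.+1 * 'C(m.+1.*2, m.+1) = m.*2.+1.*2 * 'C(m.*2, m).
Proof.
have e1 := mul_bin_diag m.+1.*2 m.
have e2 := mul_bin_down m.*2.+1 m.
have e3 : m.*2.+1 - m = m.+1 by lia.
rewrite doubleS /= e3 in e1 e2 *.
rewrite -e1 -doubleS -muln2 [m.+1 * 2]mulnC -mulnA -e2.
by rewrite mulnA mul2n.
Qed.

Lemma central_bin_ge (m : nat) : 0 < m -> 4 ^ m <= m.*2 * 'C(m.*2, m).
Proof.
elim: m => // -[_ _ // | m IHm _].
have := IHm isT; set a := m.+1 => IH; rewrite expnS.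
have rec := central_bin_rec a.
have -> : a.+1.*2 * 'C(a.+1.*2, a.+1) = 2 * a.*2.+1.*2 * 'C(a.*2, a).
  by rewrite -mulnA -rec mulnA mul2n.
apply: leq_trans (leq_mul (leqnn 4) IH) _.
by rewrite mulnA leq_mul2r; apply/orP; right; lia.
Qed.

(** Legendre's formula: each power of p contributes 0 or 1, according to
whether there is a carry when adding m to itself in base p. *)
Lemma logn_central_bin (m p : nat) : prime p ->
  logn p 'C(m.*2, m) =
    \sum_(1 <= k < m.*2.+1) (p ^ k <= m %% p ^ k + m %% p ^ k).
Proof.
move=> pr_p; have le_m : m <= m.*2 by lia.
have := congr1 (logn p) (bin_fact le_m).
have -> : m.*2 - m = m by lia.
rewrite !lognM ?muln_gt0 ?fact_gt0 ?bin_gt0 // addnn !logn_fact //.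
have -> : \sum_(1 <= k < m.*2.+1) m.*2 %/ p ^ k =
    \sum_(1 <= k < m.*2.+1) (p ^ k <= m %% p ^ k + m %% p ^ k)
      + (\sum_(1 <= k < m.*2.+1) m %/ p ^ k).*2.
  rewrite -[(\sum_(_ <= k < _) m %/ p ^ k).*2]addnn -!big_split /=.
  apply: eq_bigr => k _.
  by rewrite -[in LHS](addnn m) divnD ?expn_gt0 ?prime_gt0 // addnC.
have -> : \sum_(1 <= k < m.*2.+1) m %/ p ^ k = \sum_(1 <= k < m.+1) m %/ p ^ k.
  rewrite (big_cat_nat (n := m.+1)) //=.
  rewrite [X in _ + X]big_nat_cond [X in _ + X]big1 ?addn0 // => k.
  rewrite andbT => /andP[lt_mk _]; apply: divn_small.
  exact: ltn_trans lt_mk (ltn_expl k (prime_gt1 pr_p)).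
by move/addIn.
Qed.

(** No carry can occur at a power of p exceeding 2m, so the exponent is at most
the integer part of the logarithm of 2m in base p. *)
Lemma expn_logn_central_bin_le (m p : nat) : prime p ->
  0 < m -> p ^ logn p 'C(m.*2, m) <= m.*2.
Proof.
move=> pr_p m_gt0; have p_gt1 := prime_gt1 pr_p.
apply: leq_trans (trunc_logP p_gt1 (_ : 0 < m.*2)); last by lia.
rewrite leq_exp2l // logn_central_bin //.
set t := trunc_log p _.
have le_t : t < m.*2.+1.
  rewrite ltnS; apply: leq_trans (trunc_logP p_gt1 (_ : 0 < m.*2)); last by lia.
  exact/ltnW/ltn_expl.
rewrite (big_cat_nat (n := t.+1)) //= [X in _ + X]big_nat_cond.
rewrite [X in _ + X]big1 ?addn0.
  apply: leq_trans (_ : \sum_(1 <= k < t.+1) 1 <= _).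
    by apply: leq_sum => k _; exact: leq_b1.
  by rewrite sum_nat_const_nat subSS subn0 muln1.
move=> k /andP[/andP[lt_tk _] _]; apply/eqP; rewrite eqb0 -ltnNge.
apply: leq_ltn_trans (_ : m.*2 < _).
  by rewrite -addnn leq_add ?leq_mod.
by apply: leq_trans (trunc_log_ltn _ p_gt1) _; rewrite leq_exp2l.
Qed.

(** Here p^2 and the higher powers of p exceed 2m, so they cannot contribute. *)
Lemma logn_central_bin_large (m p : nat) : prime p -> 0 < m -> m.*2 < p ^ 2 ->
  logn p 'C(m.*2, m) = (p <= m %% p + m %% p).
Proof.
move=> pr_p m_gt0 lt_p2; rewrite logn_central_bin // big_ltn ?expn1; last by lia.
rewrite big_nat_cond big1 ?addn0 // => k /andP[/andP[le2k _] _].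
apply/eqP; rewrite eqb0 -ltnNge; apply: leq_ltn_trans (_ : m.*2 < _).
  by rewrite -addnn leq_add ?leq_mod.
by apply: leq_trans lt_p2 _; rewrite leq_exp2l // prime_gt1.
Qed.

Definition prime_count (m n : nat) : nat := \sum_(p < n.+1 | (m < p) && prime p) 1.

(** Erdos' estimate.  Among the prime powers in the factorisation of the
binomial coefficient, those of the primes p <= s are at most 2m each; the
others have exponent at most 1, and exponent 0 when 2m/3 < p <= m, since then
m modulo p is m - p < p/2.  So a lack of primes in ]m, 2m] would make the
coefficient smaller than its lower bound 4^m / (2m). *)
Lemma central_bin_le_primes (m s : nat) : 0 < m -> m.*2 < s.+1 ^ 2 ->
  4 ^ m <= m.*2 ^ (s.+2 + prime_count m m.*2) * 4 ^ (m.*2 %/ 3).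
Proof.
move=> m_gt0 lt_s; apply: leq_trans (central_bin_ge m_gt0) _.
rewrite addSn expnS -mulnA leq_mul2l; apply/orP; right.
have C_gt0 : 0 < 'C(m.*2, m) by rewrite bin_gt0; lia.
have le_p p : prime p -> p %| 'C(m.*2, m) -> p <= m.*2.
  move=> pr_p p_dvd; rewrite -(prime_dvd_fact _ pr_p).
  by rewrite -(@bin_fact m.*2 m) ?dvdn_mulr //; lia.
rewrite (prod_prime_powers C_gt0 le_p).
apply: leq_trans
  (_ : \prod_(p < m.*2.+1 | prime p) ((if p <= s then m.*2 else 1) *
     (if m < p then m.*2 else 1) * (if p <= m.*2 %/ 3 then p : nat else 1)) <= _).
  apply: leq_prod => p pr_p.
  have p_gt0 := prime_gt0 pr_p.
  case: (leqP p s) => [le_ps|lt_sp].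
    apply: leq_trans (expn_logn_central_bin_le pr_p m_gt0) _.
    rewrite -mulnA leq_pmulr //; case: ifP => _; case: ifP => _; rewrite ?muln_gt0; lia.
  have lt_p2 : m.*2 < p ^ 2.
    by apply: leq_trans lt_s _; rewrite leq_exp2r.
  rewrite logn_central_bin_large // mul1n.
  case: (leqP p (m.*2 %/ 3)) => [le_p3|lt_p3].
    apply: leq_trans (_ : p <= _); last by case: ifP; lia.
    by case: (p <= _ + _); rewrite ?expn1 ?expn0.
  case: (ltnP m p) => [lt_mp|le_pm].
    have : p <= m.*2 by have := ltn_ord p; lia.
    by case: (p <= _ + _); rewrite ?expn1 ?expn0 muln1; lia.
  have -> : m %% p = m - p by rewrite -{1}(subnK le_pm) modnDr modn_small //; lia.
  have -> : (p <= m - p + (m - p)) = false by lia.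
  by [].
rewrite !big_split /= expnD; apply: leq_mul; first apply: leq_mul.
- rewrite -big_mkcondr /= prod_nat_const leq_pexp2l //; first by lia.
  rewrite -[X in _ <= X]card_ord.
  pose f (p : 'I_m.*2.+1) : 'I_s.+1 := inord p.
  apply: (@leq_card_in _ _ f) => p q.
  rewrite -!topredE /= => /andP[_ le_ps] /andP[_ le_qs] /(congr1 val).
  by rewrite /= !inordK // => /val_inj.
- by rewrite -big_mkcondr /= prod_nat_const /prime_count sum1_card leq_pexp2l //;
    [lia | apply: subset_leq_card; apply/subsetP => p; rewrite -!topredE /= andbC].
rewrite -big_mkcondr /= -(big_mkord (fun p => prime p && (p <= m.*2 %/ 3)) id).
apply: leq_trans (primorial_le _).
rewrite (big_cat_nat (n := (m.*2 %/ 3).+1)) //=; last by lia.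
rewrite [X in _ * X]big_nat_cond [X in _ * X]big1 ?muln1; last by move=> p; lia.
rewrite -(big_mkord prime id) big_nat_cond [X in _ <= X]big_nat_cond.
by apply: eq_leq; apply: eq_bigl => p; lia.
Qed.

Local Open Scope ring_scope.

(** * Primes between h and 2h *)

Lemma ln_natX (R : realType) (a b : nat) : (0 < a)%N -> 
  ln (a ^ b)%:R = b%:R * ln a%:R :> R.
Proof. by move=> a_gt0; rewrite natrX lnXn ?ltr0n // mulr_natl. Qed.

Lemma ler_ln_nat (R : realType) (a b : nat) : (0 < a)%N -> (a <= b)%N ->
  ln a%:R <= ln b%:R :> R.
Proof.
by move=> a_gt0 le_ab; rewrite ler_ln ?posrE ?ltr0n ?ler_nat //; apply: leq_trans le_ab.
Qed.

Lemma ln_nat_ge0 (R : realType) (a : nat) : 0 <= ln a%:R :> R.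
Proof.
by case: a => [|a]; [rewrite ln0 | rewrite ln_ge0 // ler1n].
Qed.

Lemma ln2_ge_half (R : realType) : 2^-1 <= ln 2 :> R.
Proof.
have := @le_ln1Dx R (- 2^-1) ltac:(lra).
have -> : 1 + - 2^-1 = 2^-1 :> R by lra.
by rewrite lnV ?posrE //; lra.
Qed.

Lemma ln_nat_ge_half (R : realType) (a : nat) : (2 <= a)%N -> 2^-1 <= ln a%:R :> R.
Proof. by move=> le2a; apply: le_trans (ln2_ge_half R) _; apply: ler_ln_nat. Qed.

(** Taking logarithms in [central_bin_le_primes] with s about sqrt (2m), the
primes in ]m, 2m] contribute at least (m/3) ln 4 - (s + 2) ln (2m), where the
second term is of lower order. *)
Lemma chebyshev_upper_half (R : realType) :
  exists h0 : nat, forall m : nat, (h0 <= m)%N ->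
    m%:R / 6 <= (prime_count m m.*2)%:R * ln (m.*2)%:R :> R.
Proof.
exists (Num.truncn (144 ^+ 4 : R)).+1 => m le_m.
have m_big : (144 ^+ 4 : R) < m%:R.
  apply: lt_le_trans (truncnS_gt _) _; by rewrite ler_nat.
have m_gt0 : (0 < m)%N by apply: leq_trans le_m.
set x : R := (m.*2)%:R.
have x_def : x = 2 * m%:R by rewrite /x -muln2 natrM mulrC.
have m_gt0R : (0 : R) < m%:R by rewrite ltr0n.
(* As ln x <= 4 t for t = x^(1/4), the error term (s + 2) ln x is at most
   (3 t^2) (4 t), which is at most t^4 / 12 = m / 6 as soon as t >= 144. *)
set t := Num.sqrt (Num.sqrt x).
have t_ge0 : 0 <= t by exact: sqrtr_ge0.
have t4 : t ^+ 4 = x.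
  by rewrite -[4%N]/(2 * 2)%N exprM !sqr_sqrtr ?sqrtr_ge0 // /x ler0n.
have t_big : 144 <= t.
  rewrite -(@ler_pXn2r _ 4) ?nnegrE //; lra.
have t_gt0 : 0 < t by lra.
pose s := Num.truncn (t ^+ 2).
have /andP[le_s lt_s] := truncn_itv (sqr_ge0 t).
have lt_s2 : (m.*2 < s.+1 ^ 2)%N.
  rewrite -(ltr_nat R) -/x -t4 natrX -[4%N]/(2 * 2)%N exprM.
  by rewrite ltr_pXn2r ?nnegrE ?sqr_ge0.
have := central_bin_le_primes m_gt0 lt_s2.
set P := prime_count m m.*2 => le4.
have pos4 : (0 < 4 ^ m)%N by rewrite expn_gt0.
have := ler_ln_nat R pos4 le4.
rewrite natrM lnM ?posrE ?ltr0n ?expn_gt0 ?double_gt0 ?m_gt0 //.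
rewrite !ln_natX ?double_gt0 // -/x => le_ln.
have ln4 : 1 <= ln 4%:R :> R.
  by have := ln2_ge_half R; rewrite -[4%N]/(2 ^ 2)%N ln_natX //; lra.
have le_div : ((m.*2 %/ 3)%N)%:R <= 2 / 3 * m%:R :> R.
  have : ((m.*2 %/ 3) * 3)%N%:R <= x by rewrite ler_nat leq_trunc_div.
  by rewrite natrM x_def; lra.
have lnx : ln x <= 4 * t.
  rewrite -t4 lnXn // -[ln t *+ 4]mulr_natl ler_wpM2l // ltW //; exact: ln_sublinear.
have lnx_ge0 : 0 <= ln x by exact: ln_nat_ge0.
rewrite natrD in le_ln.
have s_le : (s.+2)%:R * ln x <= m%:R / 6.
  have -> : m%:R = t ^+ 4 / 2 by rewrite t4 x_def; field.
  apply: le_trans (_ : (3 * t ^+ 2) * (4 * t) <= _).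
    apply: ler_pM => //.
    have t2_ge1 : 1 <= t ^+ 2 by rewrite exprn_ege1 //; lra.
    by rewrite -[s.+2]addn2 natrD; move: le_s; rewrite -/s; lra.
  have : 0 <= t ^+ 3 * (t - 144) by rewrite mulr_ge0 ?exprn_ge0 // subr_ge0.
  rewrite !exprS expr0; lra.
have : m%:R / 3 <= m%:R / 3 * ln 4%:R :> R by rewrite ler_peMr //; lra.
have : (m.*2 %/ 3)%N%:R * ln 4%:R <= 2 / 3 * m%:R * ln 4%:R :> R.
  by rewrite ler_wpM2r //; lra.
rewrite mulrDl in le_ln; lra.
Qed.

(** * Sums of reciprocals of smooth and of rough numbers *)

(** A change of summation variable along an injection whose image need not be
identified; the sums over numbers with given prime factors are compared in
this way. *)
Lemma ler_sum_inj (R : numDomainType) (I J : finType) (P : pred I) (Q : pred J)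
    (h : I -> J) (F : I -> R) (G : J -> R) :
  {in P &, injective h} -> (forall i, P i -> Q (h i)) ->
  (forall i, P i -> F i <= G (h i)) -> (forall j, Q j -> 0 <= G j) ->
  \sum_(i | P i) F i <= \sum_(j | Q j) G j.
Proof.
move=> inj_h PQ le_FG G_ge0.
apply: le_trans (_ : \sum_(i | P i) G (h i) <= _); first exact: ler_sum.
rewrite -[X in X <= _]/(\sum_(i in P) G (h i)).
rewrite -(big_imset _ inj_h) /= [X in _ <= X](bigID (mem (h @: P))) /=.
rewrite -[X in X <= _]addr0 lerD ?sumr_ge0 // => [|j /andP[/G_ge0]//].
rewrite le_eqVlt; apply/orP; left; apply/eqP/eq_bigl => j.
case: imsetP => [[i Pi ->]|_]; rewrite ?andbF //.
by rewrite PQ.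
Qed.

Lemma ln_nat_prod (R : realType) (I : Type) (r : seq I) (P : pred I) (F : I -> nat) :
  (forall i, P i -> (0 < F i)%N) ->
  ln (\prod_(i <- r | P i) F i)%:R = \sum_(i <- r | P i) ln (F i)%:R :> R.
Proof.
move=> F_gt0.
suff [] : ((0 < \prod_(i <- r | P i) F i)%N /\
  ln (\prod_(i <- r | P i) F i)%:R = \sum_(i <- r | P i) ln (F i)%:R :> R) by [].
apply: (big_rec2 (fun (a : nat) (b : R) => (0 < a)%N /\ ln a%:R = b)).
  by rewrite ln1.
move=> i b a Pi [a_gt0 <-]; rewrite muln_gt0 a_gt0 F_gt0 //.
by rewrite natrM lnM // posrE ltr0n // F_gt0.
Qed.

Lemma fact_le_exp (n : nat) : (n`! <= n ^ n)%N.
Proof.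
elim: n => // n IHn; rewrite factS expnS leq_mul2l /=.
apply: leq_trans IHn _; by case: n => // n; rewrite leq_exp2r.
Qed.

(** The product of p^(z %/ p) over p <= z divides z!, which is at most z^z;
and z %/ p is at least z / (2p). *)
Lemma mertens_upper (R : realType) (z : nat) : (0 < z)%N ->
  \sum_(p < z.+1 | prime p) ln p%:R / p%:R <= 2 * ln z%:R :> R.
Proof.
move=> z_gt0.
have z_gt0R : 0 < z%:R :> R by rewrite ltr0n.
have le_fact : (\prod_(p < z.+1 | prime p) p ^ (z %/ p) <= z ^ z)%N.
  apply: leq_trans (fact_le_exp z).
  rewrite [X in (_ <= X)%N](@prod_prime_powers z) ?fact_gt0 //; last first.
    by move=> p pr_p; rewrite prime_dvd_fact.
  apply: leq_prod => p pr_p; rewrite leq_exp2l ?prime_gt1 // logn_fact //.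
  by rewrite big_ltn // expn1 leq_addr.
have prod_gt0 : (0 < \prod_(p < z.+1 | prime p) p ^ (z %/ p))%N.
  by rewrite prodn_cond_gt0 // => p pr_p; rewrite expn_gt0 prime_gt0.
have := ler_ln_nat R prod_gt0 le_fact.
rewrite ln_nat_prod => [|p pr_p]; last by rewrite expn_gt0 prime_gt0.
rewrite ln_natX // => le_ln.
rewrite -(ler_pM2l z_gt0R) mulrCA.
apply: le_trans (_ : 2 * \sum_(p < z.+1 | prime p) ln (p ^ (z %/ p))%:R <= _); last first.
  by rewrite ler_wpM2l.
rewrite !mulr_sumr; apply: ler_sum => p pr_p.
have p_gt0 := prime_gt0 pr_p; have p_gt0R : 0 < p%:R :> R by rewrite ltr0n.
rewrite ln_natX //.
have key : z%:R / p%:R <= 2 * (z %/ p)%N%:R :> R.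
  rewrite ler_pdivrMr // -natrM -natrM ler_nat.
  have le_pz : (p <= z)%N by rewrite -ltnS ltn_ord.
  have q_gt0 : (0 < z %/ p)%N by rewrite divn_gt0.
  by apply: ltnW; apply: (leq_trans (ltn_ceil z p_gt0)); rewrite leq_mul2r; lia.
have := ler_wpM2r (ln_nat_ge0 R p) key; lra.
Qed.

Definition smooth_sum (R : realType) (z N : nat) : R :=
  \sum_(s < N.+1 | (upto z).-nat s) s%:R^-1.

Lemma smooth_sum_ge0 (R : realType) (z N : nat) : 0 <= smooth_sum R z N.
Proof. by apply: sumr_ge0 => s _; rewrite invr_ge0 ler0n. Qed.

(** Let T be the left-hand side.  Only multiples s = p s' of p contribute to
T, and the valuation of s is one more than that of s'; hence T <= (S + T) / p
where S is the smooth sum, and T <= S / (p - 1).  This plays the part of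
summing over the powers of p. *)
Lemma smooth_sum_logn (R : realType) (z N p : nat) : prime p ->
  \sum_(s < N.+1 | (upto z).-nat s) (logn p s)%:R / s%:R
    <= 2 / p%:R * smooth_sum R z N.
Proof.
move=> pr_p; set T := \sum_(s < _ | _) _; set S := smooth_sum _ _ _.
have p_gt0 := prime_gt0 pr_p.
have p_ge2 : 2 <= p%:R :> R by rewrite ler_nat prime_gt1.
have p_gt0R : 0 < p%:R :> R by lra.
have T_le : T <= (S + T) / p%:R.
  rewrite /S /smooth_sum -big_split /= mulr_suml.
  rewrite /T (bigID (fun s : 'I_N.+1 => (p %| s)%N)) /=.
  rewrite [X in _ + X]big1 ?addr0; last first.
    move=> s /andP[sm_s ndvd_s]; suff -> : logn p s = 0%N by rewrite mul0r.
    by apply/eqP; rewrite -leqn0 leqNgt logn_gt0 mem_primes (negbTE ndvd_s) !andbF.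
  have lt_div (s : 'I_N.+1) : (s %/ p < N.+1)%N.
    exact: leq_ltn_trans (leq_div _ _) (ltn_ord s).
  apply: (@ler_sum_inj _ _ _ _ _ (fun s => Ordinal (lt_div s))).
  - move=> s t; rewrite -!topredE /= => /andP[_ dvd_s] /andP[_ dvd_t] /(congr1 val) /= eq_st.
    by apply: val_inj; rewrite /= -(divnK dvd_s) eq_st divnK.
  - move=> s /andP[sm_s dvd_s] /=; apply: pnat_dvd sm_s.
    by rewrite dvdn_div.
  - move=> s /andP[sm_s dvd_s] /=.
    have s_gt0 : (0 < s)%N by case/andP: sm_s.
    have q_gt0 : (0 < s %/ p)%N by rewrite divn_gt0 // dvdn_leq.
    have q_gt0R : 0 < (s %/ p)%N%:R :> R by rewrite ltr0n.
    rewrite -{1 2}(divnK dvd_s) lognM // (logn_prime p pr_p) eqxx /= natrM natrD.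
    rewrite le_eqVlt; apply/orP; left; apply/eqP; field.
    by rewrite !gt_eqF.
  - move=> s _; apply: divr_ge0; last exact: ler0n.
    by apply: addr_ge0; rewrite ?invr_ge0 ?divr_ge0 ?ler0n.
have S_ge0 : 0 <= S := smooth_sum_ge0 _ _ _.
rewrite ler_pdivlMr // in T_le.
have T_ge0 : 0 <= T by apply: sumr_ge0 => s _; rewrite divr_ge0 ?ler0n.
have h : T * 2 <= T * p%:R by rewrite ler_wpM2l.
have : T * p%:R <= 2 * S by lra.
by rewrite -ler_pdivlMr // mulrAC.
Qed.

(** Up to the factor S, the left-hand side is the mean of ln s for the weight
1/s on smooth numbers: it is of order ln z, whatever the bound N. *)
Lemma smooth_sum_ln (R : realType) (z N : nat) : (0 < z)%N ->
  \sum_(s < N.+1 | (upto z).-nat s) ln s%:R / s%:R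
    <= 4 * ln z%:R * smooth_sum R z N.
Proof.
move=> z_gt0.
have -> : \sum_(s < N.+1 | (upto z).-nat s) ln s%:R / s%:R =
   \sum_(p < z.+1 | prime p) ln p%:R * 
      \sum_(s < N.+1 | (upto z).-nat s) (logn p s)%:R / s%:R :> R.
  under [RHS]eq_bigr do rewrite mulr_sumr.
  rewrite exchange_big /=; apply: eq_bigr => s sm_s.
  have s_gt0 : (0 < s)%N by case/andP: sm_s.
  rewrite {1}(@prod_prime_powers z s) //; last first.
    by move=> p pr_p p_dvd; apply: (pnatPpi sm_s); rewrite mem_primes pr_p s_gt0.
  rewrite ln_nat_prod; last by move=> p pr_p; rewrite expn_gt0 prime_gt0.
  rewrite mulr_suml; apply: eq_bigr => p pr_p.
  by rewrite ln_natX ?prime_gt0 //; field; rewrite pnatr_eq0 -lt0n.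
apply: le_trans (_ : \sum_(p < z.+1 | prime p)
   ln p%:R / p%:R * (2 * smooth_sum R z N) <= _).
  apply: ler_sum => p pr_p.
  have := ler_wpM2l (ln_nat_ge0 R p) (smooth_sum_logn R z N pr_p); lra.
rewrite -mulr_suml.
have := smooth_sum_ge0 R z N; set S := smooth_sum _ _ _ => S_ge0.
have := ler_wpM2r (mulr_ge0 (ler0n R 2) S_ge0) (mertens_upper R z_gt0); lra.
Qed.

Definition harmonic (R : realType) (n : nat) : R := \sum_(t < n.+1 | (0 < t)%N) t%:R^-1.

Lemma harmonicS (R : realType) (n : nat) :
  harmonic R n.+1 = harmonic R n + n.+1%:R^-1.
Proof. by rewrite /harmonic big_mkcond big_ord_recr /= -big_mkcond. Qed.

Lemma harmonic_ge (R : realType) (n : nat) : ln n.+1%:R <= harmonic R n.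
Proof.
elim: n => [|n IHn]; first by rewrite ln1 /harmonic sumr_ge0 // => t _; rewrite invr_ge0.
rewrite harmonicS.
have n_gt0 : 0 < n.+1%:R :> R by rewrite ltr0n.
have inv_gt0 : 0 < n.+1%:R^-1 :> R by rewrite invr_gt0.
have := le_ln1Dx (lt_trans (ltrN10 R) inv_gt0).
have -> : 1 + n.+1%:R^-1 = n.+2%:R / n.+1%:R :> R.
  by rewrite -[n.+2]addn1 natrD mulrDl divff ?gt_eqF // mul1r.
by rewrite ln_div ?posrE // lerBlDl => h; apply: (le_trans h); apply: lerD.
Qed.

Lemma harmonic_le (R : realType) (n : nat) : harmonic R n <= 1 + ln n%:R.
Proof.
elim: n => [|n IHn].
  by rewrite /harmonic big_mkcond big_ord_recr big_ord0 /= ln0 // !addr0 ler01.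
rewrite harmonicS; case: n IHn => [_|n IHn].
  by rewrite /harmonic big_mkcond big_ord_recr big_ord0 /= ln1 !addr0 add0r invr1.
have n_gt0 : 0 < n.+1%:R :> R by rewrite ltr0n.
have n2_gt0 : 0 < n.+2%:R :> R by rewrite ltr0n.
have inv_lt1 : -1 < - n.+2%:R^-1 :> R by rewrite ltrN2 invf_lt1 // ltr1n.
have := le_ln1Dx inv_lt1.
have -> : 1 - n.+2%:R^-1 = n.+1%:R / n.+2%:R :> R.
  have -> : n.+1%:R = n.+2%:R - 1 :> R by rewrite -[n.+2]addn1 natrD addrK.
  by rewrite mulrBl divff ?gt_eqF // mul1r.
rewrite ln_div ?posrE // lerBlDl lerBrDr => h.
by apply: le_trans (lerD IHn (lexx _)) _; rewrite -addrA lerD2l.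
Qed.

(** Markov's inequality: by [smooth_sum_ln] the mean of ln s is at most
4 ln z, so that the s beyond Y = z^8 carry at most half of the weight.  The
other half is at most a harmonic sum up to Y. *)
Lemma smooth_sum_le (R : realType) (z N : nat) : (2 <= z)%N ->
  smooth_sum R z N <= 2 + 16 * ln z%:R.
Proof.
move=> z_ge2; have z_gt0 : (0 < z)%N by lia.
have lnz := ln_nat_ge_half R z_ge2.
pose Y := (z ^ 8)%N.
have := smooth_sum_ln R N z_gt0.
have := smooth_sum_ge0 R z N; set S := smooth_sum _ _ _ => S_ge0 le_ln.
have lnY : ln Y%:R = 8 * ln z%:R :> R by rewrite ln_natX.
have Y_gt0 : (0 < Y)%N by rewrite expn_gt0 z_gt0.
have split_S : S <= harmonic R Y
   + (\sum_(s < N.+1 | (upto z).-nat s) ln s%:R / s%:R) / ln Y%:R.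
  rewrite /S /smooth_sum (bigID (fun s : 'I_N.+1 => (s <= Y)%N)) /= lerD //.
    apply: (@ler_sum_inj _ _ _ _ _ (fun s : 'I_N.+1 => inord s : 'I_Y.+1)).
    - move=> s t; rewrite -!topredE /= => /andP[_ le_s] /andP[_ le_t] /(congr1 val).
      by rewrite /= !inordK // => /val_inj.
    - by move=> s /andP[/andP[s_gt0 _] le_s]; rewrite inordK.
    - by move=> s /andP[_ le_s]; rewrite inordK.
    - by move=> s _; rewrite invr_ge0.
  rewrite mulr_suml [X in _ <= X](bigID (fun s : 'I_N.+1 => (s <= Y)%N)) /=.
  rewrite -[X in X <= _]add0r lerD //.
    by apply: sumr_ge0 => s _; rewrite !divr_ge0 ?ln_nat_ge0.
  apply: ler_sum => s /andP[/andP[s_gt0 _]]; rewrite -ltnNge => lt_Ys.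
  have s_gt0R : 0 < s%:R :> R by rewrite ltr0n.
  rewrite mulrAC -[X in X <= _]mul1r ler_wpM2r ?invr_ge0 ?ler0n //.
  rewrite ler_pdivlMr ?mul1r; last by rewrite lnY; lra.
  by apply: ler_ln_nat => //; exact: ltnW.
have hY := harmonic_le R Y; rewrite lnY in hY split_S.
have : (\sum_(s < N.+1 | (upto z).-nat s) ln s%:R / s%:R) / (8 * ln z%:R) <= S / 2.
  by rewrite ler_pdivrMr; lra.
lra.
Qed.

Definition rough_sum (R : realType) (z N : nat) : R :=
  \sum_(m < N.+1 | (upto z)^'.-nat m) m%:R^-1.

(** Splitting t into its smooth and rough parts embeds the harmonic sum into
the product of the smooth and the rough sums. *)
Lemma rough_sum_ge (R : realType) (z N : nat) : (2 <= z)%N ->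
  ln N.+1%:R <= rough_sum R z N * (2 + 16 * ln z%:R).
Proof.
move=> z_ge2; apply: le_trans (harmonic_ge _ _) _.
have rough_ge0 : 0 <= rough_sum R z N.
  by apply: sumr_ge0 => s _; rewrite invr_ge0.
apply: le_trans (_ : rough_sum R z N * smooth_sum R z N <= _); last first.
  by rewrite ler_wpM2l // smooth_sum_le.
rewrite /rough_sum /smooth_sum big_distrlr /= pair_big /=.
have lt_part pi (t : 'I_N.+1) : (0 < t)%N -> (t`_pi < N.+1)%N.
  move=> t_gt0; apply: leq_ltn_trans (ltn_ord t).
  by apply: dvdn_leq => //; exact: dvdn_part.
apply: (@ler_sum_inj _ _ _ _ _
  (fun t : 'I_N.+1 => (inord t`_(upto z)^', inord t`_(upto z)) : 'I_N.+1 * 'I_N.+1)).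
- move=> t u; rewrite -!topredE /= => t_gt0 u_gt0 [].
  move=> /(congr1 val) /= e1 /(congr1 val) /= e2; apply: val_inj => /=.
  rewrite !inordK ?lt_part // in e1 e2.
  by rewrite -(partnC (upto z) t_gt0) -(partnC (upto z) u_gt0) e1 e2.
- by move=> t t_gt0 /=; rewrite !inordK ?lt_part // !part_pnat.
- move=> t t_gt0 /=; rewrite !inordK ?lt_part //.
  by rewrite -invfM -natrM mulnC partnC.
- by move=> [m s] _ /=; rewrite mulr_ge0 // invr_ge0.
Qed.

(** * Rough numbers between n/2 and n *)

Lemma sum1_rough_upper_half (R : realType) (z n : nat) :
  \sum_(b < n.+1 | (n < b.*2)%N && (upto z)^'.-nat b) 1
    = (#|` rough_upper_half z n|)%:R :> R.
Proof.
rewrite /rough_upper_half.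
have -> : #|` [fset b in iota 1 n | (n < b.*2)%N && (upto z)^'.-nat b]%fset|
    = size [seq b <- iota 1 n | (n < b.*2)%N && (upto z)^'.-nat b].
  set s := filter _ _; have uniq_s : uniq s by rewrite filter_uniq ?iota_uniq.
  rewrite -(undup_id uniq_s) -card_fseq.
  by congr #|` _|; apply/fsetP => b; rewrite !inE /= mem_filter andbC.
rewrite size_filter -sum1_count natr_sum.
rewrite -(big_mkord (fun b => (n < b.*2)%N && (upto z)^'.-nat b) (fun => 1)).
rewrite big_mkcond big_ltn //= add0r -big_mkcond /index_iota subn1 /=.
by [].
Qed.

(** From (2M)^2 <= n < 2 m p and m <= M follows p > M.  Hence p exceeds z, so
that m p is rough, and p does not divide any m' <= M, so that m p determines
p and m. *)
Lemma sum_prime_cofactors_le (R : realType) (z n M : nat) :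
  (z <= M)%N -> (M.*2 ^ 2 <= n)%N ->
  \sum_(m < M.+1 | (upto z)^'.-nat m)
    \sum_(p < n.+1 | [&& prime p, m * p <= n & n < (m * p).*2]%N) 1
  <= (#|` rough_upper_half z n|)%:R :> R.
Proof.
move=> le_zM le_Mn; rewrite -sum1_rough_upper_half pair_big_dep /=.
have lt_Mp (m p : nat) : (m <= M)%N -> (n < (m * p).*2)%N -> (M < p)%N.
  move=> le_m lt_n; rewrite ltnNge; apply/negP => le_pM.
  have : (m * p <= M * M)%N by rewrite leq_mul.
  move: le_Mn; rewrite expnS expn1; move: lt_n; lia.
apply: (@ler_sum_inj _ _ _ _ _
  (fun u : 'I_M.+1 * 'I_n.+1 => inord (u.1 * u.2)%N : 'I_n.+1)) => //.
- move=> [m p] [m' p']; rewrite -!topredE /=.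
  move=> /andP[rm /and3P[pr_p le_p lt_p]] /andP[rm' /and3P[pr_p' le_p' lt_p']].
  move=> /(congr1 val); rewrite /= !inordK // => eq_mp.
  have m_gt0 : (0 < m)%N by case/andP: rm.
  have m'_gt0 : (0 < m')%N by case/andP: rm'.
  have : (p %| m' * p')%N by rewrite -eq_mp dvdn_mull.
  rewrite Euclid_dvdM // => /orP[/dvdn_leq|].
    move=> /(_ m'_gt0) le_pm'; have := lt_Mp m p; have := ltn_ord m; have := ltn_ord m'; lia.
  rewrite dvdn_prime2 // => /eqP/val_inj eq_p; rewrite -eq_p in eq_mp *.
  by congr (_, _); apply: val_inj; apply/eqP; rewrite -(eqn_pmul2r (prime_gt0 pr_p)) eq_mp.
- move=> [m p] /= /andP[rm /and3P[pr_p le_p lt_p]]; rewrite inordK //.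
  rewrite lt_p pnatM rm /= pnatE // !inE -ltnNge.
  by apply: leq_ltn_trans le_zM _; apply: lt_Mp lt_p; rewrite -ltnS.
Qed.

(** With h = (n %/ m) / 2, the primes of ]h, 2h] are admissible cofactors of m:
m p <= 2 h m <= n, and 2 p m >= (2 h + 2) m > n. *)
Lemma prime_cofactors_ge (R : realType) (m n : nat) : (0 < m)%N ->
  (prime_count (n %/ m)./2 (n %/ m)./2.*2)%:R
    <= \sum_(p < n.+1 | [&& prime p, m * p <= n & n < (m * p).*2]%N) 1 :> R.
Proof.
move=> m_gt0; set h := (n %/ m)./2; rewrite /prime_count natr_sum.
have le_h : (h.*2 * m <= n)%N.
  apply: leq_trans (leq_trunc_div n m); rewrite leq_mul2r; apply/orP; right.
  by rewrite /h; lia.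
have le_hn : (h.*2 <= n)%N by apply: leq_trans le_h; rewrite leq_pmulr.
apply: (@ler_sum_inj _ _ _ _ _ (fun p : 'I_h.*2.+1 => inord p : 'I_n.+1)) => //.
  move=> p q _ _ /(congr1 val); have := ltn_ord p; have := ltn_ord q => lt_q lt_p.
  by rewrite /= !inordK => [/val_inj //||]; lia.
move=> p /andP[lt_hp pr_p]; have lt_p := ltn_ord p.
rewrite inordK; last by lia.
rewrite pr_p /=; apply/andP; split.
  by apply: leq_trans le_h; rewrite mulnC leq_mul2r; apply/orP; right; lia.
apply: leq_trans (ltn_ceil n m_gt0) _.
rewrite doubleMr [X in (_ <= X)%N]mulnC leq_mul2r; apply/orP; right.
have le_nh : (n %/ m <= h.*2.+1)%N by rewrite /h; lia.
by apply: leq_ltn_trans le_nh _; rewrite -[(h.*2.+1 < _)%N]/(h.+1.*2 <= _)%N leq_double.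
Qed.

(** For M about sqrt n / 2, each m <= M has a number of prime cofactors at
least n / (24 m ln n); the rough sum over m <= M is at least
ln (M + 1) / (2 + 16 ln z) and both ln n <= 4 ln (M + 1) and
2 + 16 ln z <= 20 ln z hold, whence the constant 24 * 4 * 20 = 1920. *)
Lemma rough_upper_half_ge (R : realType) : exists (c : R) (N1 : nat), 0 < c /\
  forall z n : nat, (2 <= z)%N -> (N1 <= n)%N -> (z.*2 ^ 2 <= n)%N ->
    c * (n%:R / ln z%:R) <= (#|` rough_upper_half z n|)%:R.
Proof.
have [h0 cheb] := chebyshev_upper_half R.
exists 1920^-1, (h0.+1.*2 ^ 2)%N; split=> [|z n z_ge2 n_big le_zn].
  by rewrite invr_gt0.
have [M le_Mn lt_nM] : exists2 M, (M.*2 ^ 2 <= n)%N & (n < M.+1.*2 ^ 2)%N.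
  have exM : exists M, (M.*2 ^ 2 <= n)%N by exists z.
  have ubM M : (M.*2 ^ 2 <= n)%N -> (M <= n)%N.
    by rewrite expnS expn1; case: M => // M; apply: leq_trans; lia.
  case: (ex_maxnP exM ubM) => M le_M max_M; exists M => //.
  by rewrite ltnNge; apply/negP => /max_M; rewrite ltnn.
have le_M k : (k.*2 ^ 2 <= n)%N -> (k <= M)%N.
  move=> le_k; rewrite -ltnS -ltn_double -(@ltn_exp2r _ _ 2) //.
  exact: leq_ltn_trans lt_nM.
have le_zM := le_M _ le_zn; have lt_h0M := le_M _ n_big.
have n_gt0 : (0 < n)%N by apply: leq_trans le_zn; rewrite expn_gt0; lia.
have n_gt0R : 0 < n%:R :> R by rewrite ltr0n.
have lnz := ln_nat_ge_half R z_ge2.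
have n_ge2 : (2 <= n)%N by apply: leq_trans le_zn; rewrite expnS expn1; lia.
have lnn := ln_nat_ge_half R n_ge2.
apply: le_trans (sum_prime_cofactors_le R le_zM le_Mn).
apply: le_trans (_ : n%:R / (24 * ln n%:R) * rough_sum R z M <= _); last first.
  rewrite /rough_sum mulr_sumr; apply: ler_sum => m rough_m.
  have m_gt0 : (0 < m)%N by case/andP: rough_m.
  have m_gt0R : 0 < m%:R :> R by rewrite ltr0n.
  have le_mM : (m <= M)%N by rewrite -ltnS.
  apply: le_trans (prime_cofactors_ge R n m_gt0).
  set h := (n %/ m)./2.
  have le_M4 : (M * 4 <= n %/ m)%N.
    rewrite leq_divRL //; apply: leq_trans le_Mn; rewrite expnS expn1.
    apply: leq_trans (_ : M * 4 * M <= _)%N; last by lia.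
    by rewrite leq_mul2l le_mM orbT.
  have h_ge : (h0 <= h)%N by rewrite /h; lia.
  have h_gt0 : (0 < h)%N by rewrite /h; lia.
  have le_nh : (n <= 4 * h * m)%N.
    apply: ltnW; apply: leq_trans (ltn_ceil n m_gt0) _.
    by rewrite leq_mul2r; apply/orP; right; rewrite /h in h_gt0 *; lia.
  have le_hn : (h.*2 <= n)%N.
    apply: leq_trans (leq_div n m); rewrite /h; lia.
  have h2_ge2 : (2 <= h.*2)%N by lia.
  have h2_gt0 : (0 < h.*2)%N by lia.
  have lnh := ln_nat_ge_half R h2_ge2.
  have lnhn := ler_ln_nat R h2_gt0 le_hn.
  have := cheb _ h_ge; set P := (prime_count _ _)%:R => cheb_h.
  have P_ge0 : 0 <= P by rewrite /P ler0n.
  have : h%:R / 6 <= P * ln n%:R by apply: le_trans cheb_h _; rewrite ler_wpM2l.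
  have : n%:R <= 4 * h%:R * m%:R :> R by rewrite -!natrM ler_nat.
  move=> le_n le_h.
  rewrite ler_pdivrMr // ler_pdivrMr; last by rewrite mulr_gt0 //; lra.
  apply: (le_trans le_n).
  have := ler_wpM2r (ltW m_gt0R) le_h; lra.
have M_ge2 : (2 <= M.+1)%N by lia.
have lnM1 := ln_nat_ge_half R M_ge2.
have lnn_le : ln n%:R <= 4 * ln M.+1%:R :> R.
  apply: le_trans (ler_ln_nat R n_gt0 (ltnW lt_nM)) _.
  rewrite ln_natX // -muln2 natrM lnM ?posrE //.
  by have := ler_ln_nat R (isT : 0 < 2)%N M_ge2; lra.
have := rough_sum_ge R M z_ge2; set G := rough_sum R z M => le_G.
have G_ge0 : 0 <= G by apply: sumr_ge0 => m _; rewrite invr_ge0.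
have : ln M.+1%:R <= G * (20 * ln z%:R).
  by apply: le_trans le_G _; rewrite ler_wpM2l //; lra.
move=> {}le_G.
rewrite mulrCA -invfM ler_pdivrMr; last by rewrite mulr_gt0 //; lra.
have -> : n%:R / (24 * ln n%:R) * G * (1920 * ln z%:R)
    = n%:R * (G * (1920 * ln z%:R)) / (24 * ln n%:R) by ring.
rewrite ler_pdivlMr; last by rewrite mulr_gt0 //; lra.
by rewrite ler_wpM2l //; lra.
Qed.

(** * Choice of the sieving level, and conclusion *)

(** The level is z = floor u with u = Q k^(1 + e/4).  The factor k^(e/4)
absorbs the logarithm in the third condition, provided the constant Q is large
enough in terms of D and e; and u^2 is at most a constant times n^theta with
theta = (2 + e/2) / (2 + e) < 1, so the second condition holds once n is
large. *)
Lemma sieving_level (R : realType) (D e : R) : 0 < D -> 0 < e -> e <= 1 ->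
  exists (C : R) (N0 : nat), 0 < C /\ forall k n : nat,
    (2 <= k)%N -> (N0 <= n)%N -> k%:R `^ (2 + e) <= n%:R ->
    exists z : nat, [/\ (2 <= z)%N, (z.*2 ^ 2 <= n)%N,
      D * k%:R * ln z%:R <= z%:R :> R & ln z%:R <= C * ln k%:R].
Proof.
move=> D_gt0 e_gt0 e_le1.
have De_gt0 : 0 < D / e by rewrite divr_gt0.
(* Q is taken to be a square since ln Q <= 2 sqrt Q; q is then chosen so that
   both terms of [Q_large] below are at most Q / 2. *)
pose q : R := 8 * D + 32 * (D / e) + 4.
have q_big : 4 <= q by rewrite /q; lra.
have q_gt0 : 0 < q by lra.
pose Q := q ^+ 2.
have Q_ge : q <= Q by rewrite /Q expr2 ler_peMr; lra.
have Q_gt0 : 0 < Q by lra.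
have lnQ : ln Q <= 2 * q.
  by rewrite /Q lnXn // -[ln q *+ 2]mulr_natl ler_wpM2l // ltW // ln_sublinear.
have lnQ_ge0 : 0 <= ln Q by apply: ln_ge0; lra.
have Q_large : 2 * D * (ln Q + 8 / e) <= Q.
  have h1 : 2 * D * ln Q <= 2 * D * (2 * q) by rewrite ler_wpM2l // mulr_ge0 // ltW.
  have h2 : 8 * D * q <= Q by rewrite /Q expr2 ler_wpM2r; rewrite /q; lra.
  have h3 : 32 * (D / e) <= q by rewrite /q; lra.
  lra.
pose theta := (2 + e / 2) / (2 + e).
have e2_gt0 : 0 < 2 + e by lra.
have theta_lt1 : 0 < 1 - theta.
  have -> : 1 - theta = e / 2 / (2 + e) by rewrite /theta; field; lra.
  by rewrite !divr_gt0.
have theta_gt0 : 0 < theta by rewrite divr_gt0 //; lra.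
pose N0 := (Num.truncn ((4 * Q ^+ 2) `^ (1 - theta)^-1)).+1.
exists (2 * ln Q + 2), N0; split; first lra.
move=> k n k_ge2 n_big le_kn.
have k_ge2R : 2 <= k%:R :> R by rewrite ler_nat.
have k_gt0 : 0 < k%:R :> R by lra.
have lnk := ln_nat_ge_half R k_ge2.
have n_gt0 : (0 < n)%N by apply: leq_trans n_big.
have n_gt0R : 0 < n%:R :> R by rewrite ltr0n.
pose W : R := k%:R `^ (e / 4).
have W_ge1 : 1 <= W.
  by rewrite -(powRr0 k%:R); apply: ler_powR; lra.
pose u : R := Q * (k%:R * W).
have lnkW : ln k%:R <= 4 / e * W.
  have := ln_sublinear (lt_le_trans ltr01 W_ge1); rewrite {1}/W ln_powR => /ltW le_W.
  have : 4 / e * (e / 4 * ln k%:R) <= 4 / e * W by rewrite ler_wpM2l // divr_ge0 // ltW.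
  by have -> : 4 / e * (e / 4 * ln k%:R) = ln k%:R by field; lra.
have kW_gt0 : 0 < k%:R * W by rewrite mulr_gt0 //; lra.
have u_big : 4 <= u.
  have kW_ge1 : 1 <= k%:R * W by rewrite -[1]mulr1 ler_pM //; lra.
  by rewrite /u -[4]mulr1 ler_pM //; lra.
have u_gt0 : 0 < u by lra.
have lnu : ln u = ln Q + (1 + e / 4) * ln k%:R.
  by rewrite /u !lnM ?posrE // /W ?ln_powR ?mulr_gt0 ?powR_gt0 //; ring.
have u_sq : u ^+ 2 = Q ^+ 2 * k%:R `^ (2 + e / 2).
  have kD x y : k%:R `^ (x + y) = k%:R `^ x * k%:R `^ y :> R.
    by rewrite powRD // (gt_eqF k_gt0) implybT.
  have -> : 2 + e / 2 = 1 + 1 + (e / 4 + e / 4) by lra.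
  by rewrite !kD powRr1 ?ltW // -/W /u; ring.
have [/andP[le_zu lt_uz]] := truncn_itv (ltW u_gt0).
set z := Num.truncn u in le_zu lt_uz.
exists z.
have z_ge : u / 2 <= z%:R.
  by move: lt_uz; rewrite -natr1; lra.
have z_ge2 : (2 <= z)%N by rewrite -(ler_nat R); lra.
have lnz : ln z%:R <= ln u by rewrite ler_ln ?posrE //; lra.
split=> //.
- rewrite -(ler_nat R) natrX -muln2 natrM exprMn.
  apply: le_trans (_ : u ^+ 2 * 2 ^+ 2 <= _).
    apply: ler_wpM2r; first exact: exprn_ge0.
    by rewrite ler_pXn2r ?nnegrE // ltW.
  have le_theta : k%:R `^ (2 + e / 2) <= n%:R `^ theta.
    have -> : 2 + e / 2 = (2 + e) * theta by rewrite /theta; field; lra.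
    rewrite powRrM; apply: ge0_ler_powR => //; rewrite ?nnegrE ?powR_ge0 ?ler0n //.
    exact: ltW.
  have le_Q : 4 * Q ^+ 2 <= n%:R `^ (1 - theta).
    have Q4_ge0 : 0 <= 4 * Q ^+ 2 by rewrite mulr_ge0 ?sqr_ge0.
    have {1}-> : 4 * Q ^+ 2 = ((4 * Q ^+ 2) `^ (1 - theta)^-1) `^ (1 - theta).
      by rewrite -powRrM mulVf ?gt_eqF // powRr1.
    apply: ge0_ler_powR; rewrite ?nnegrE ?powR_ge0 ?ler0n //; first exact: ltW.
    apply: ltW; apply: lt_le_trans (truncnS_gt _) _.
    by rewrite ler_nat.
  have -> : n%:R = n%:R `^ (1 - theta) * n%:R `^ theta :> R.
    rewrite -powRD ?(gt_eqF n_gt0R) ?implybT //.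
    by rewrite subrK powRr1 // ler0n.
  have QQ_ge0 : 0 <= Q ^+ 2 * 2 ^+ 2 by apply: mulr_ge0; exact: sqr_ge0.
  rewrite u_sq mulrAC; apply: ler_pM => //; first exact: powR_ge0.
  by rewrite mulrC expr2 -natrM.
- apply: le_trans z_ge.
  apply: le_trans (_ : D * k%:R * ((ln Q + 8 / e) * W) <= _).
    rewrite ler_wpM2l //; first by rewrite mulr_ge0 //; lra.
    apply: (le_trans lnz); rewrite lnu [X in _ <= X]mulrDl lerD //; first by rewrite ler_peMr.
    have : (1 + e / 4) * ln k%:R <= 2 * (4 / e * W) by apply: ler_pM; lra.
    lra.
  have := ler_wpM2r (ltW kW_gt0) Q_large; rewrite -/u; lra.
- apply: (le_trans lnz); rewrite lnu.
  have : (1 + e / 4) * ln k%:R <= 2 * ln k%:R by rewrite ler_wpM2r; lra.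
  have : ln Q * 1 <= ln Q * (2 * ln k%:R) by rewrite ler_wpM2l //; lra.
  lra.
Qed.

Theorem theorem1p4 (R : realType) (eps : R) (heps : 0 < eps) :
  exists c : R, 0 < c /\
    forall (A : {fset nat}) (n : nat),
      positive_fset A ->
      (2 <= #|` A|)%N ->
      (#|` A|)%:R `^ (2 + eps) <= n%:R ->
      c * ((#|` A|)%:R * n%:R / ln (#|` A|)%:R)
        <= (#|` odd_product A (initial_segment n)|)%:R.
Proof.
(* A smaller exponent only weakens the hypothesis on n. *)
pose e := Num.min eps 1.
have e_gt0 : 0 < e by rewrite lt_min heps ltr01.
have e_le1 : e <= 1 by rewrite ge_min lexx orbT.
have e_leps : e <= eps by rewrite ge_min lexx.
have [c1 [N1 [c1_gt0 rough_ge]]] := rough_upper_half_ge R.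
have [D D_gt0 c1_def] : exists2 D : R, 0 < D & c1 = 2 / D.
  exists (2 / c1); first exact: divr_gt0.
  by rewrite invf_div mulrC divfK ?pnatr_eq0.
have [C [N0 [C_gt0 level]]] := sieving_level D_gt0 e_gt0 e_le1.
pose N := maxn N0 N1.
have N2_ge0 : 0 <= N%:R ^+ 2 :> R by rewrite sqr_ge0.
have DC_gt0 : 0 < D * C by rewrite mulr_gt0.
have cI_gt0 : 0 < D * C + 2 * N%:R ^+ 2 by lra.
exists (D * C + 2 * N%:R ^+ 2)^-1; split; first by rewrite invr_gt0.
move=> A n pos_A; set k := #|` A| => k_ge2 le_kn.
have k_gt0N : (0 < k)%N by apply: leq_trans k_ge2.
have k_gt0 : 0 < k%:R :> R by rewrite ltr0n.
have k_ge1 : 1 <= k%:R :> R by rewrite ler1n.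
have lnk := ln_nat_ge_half R k_ge2.
have lnk_gt0 : 0 < ln k%:R :> R by lra.
have le_kn1 : k%:R <= n%:R :> R.
  by apply: le_trans le_kn; apply: le1r_powR; lra.
have n_gt0R : 0 < n%:R :> R by lra.
have n_gt0 : (0 < n)%N by rewrite -(ltr0n R).
set S := #|` odd_product _ _|.
(* Below N the required bound is at most 1. *)
have [lt_nN|le_Nn] := ltnP n N.
  have S_ge1 : 1 <= S%:R :> R.
    by rewrite ler1n; apply: odd_product_nonempty.
  apply: le_trans S_ge1; rewrite mulrC ler_pdivrMr // mul1r ler_pdivrMr //.
  have le_nN : n%:R <= N%:R :> R by rewrite ler_nat ltnW.
  have : k%:R * n%:R <= N%:R ^+ 2 :> R by rewrite expr2; apply: ler_pM; lra.
  have : N%:R ^+ 2 * 1 <= N%:R ^+ 2 * (2 * ln k%:R) :> R by rewrite ler_wpM2l; lra.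
  have : 0 <= D * C * ln k%:R by apply/ltW/mulr_gt0.
  lra.
have le_N0 : (N0 <= n)%N by apply: leq_trans le_Nn; rewrite leq_maxl.
have le_N1 : (N1 <= n)%N by apply: leq_trans le_Nn; rewrite leq_maxr.
have le_kne : k%:R `^ (2 + e) <= n%:R :> R.
  by apply: le_trans le_kn; apply: ler_powR => //; lra.
have [z [z_ge2 le_zn z_big lnz]] := level k n k_ge2 le_N0 le_kne.
have z_gt0 : (0 < z)%N by apply: leq_trans z_ge2.
have z_gt0R : 0 < z%:R :> R by rewrite ltr0n.
have lnz_ge := ln_nat_ge_half R z_ge2.
have lnz_gt0 : 0 < ln z%:R :> R by lra.
have := card_odd_product_ge n pos_A z_gt0; rewrite -/k -/S -(ler_nat R).
rewrite natrD !natrM => le_S.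
have le_B := rough_ge z n z_ge2 le_N1 le_zn.
have le_nz : (n %/ z)%N%:R <= n%:R / z%:R :> R.
  by rewrite ler_pdivlMr // -natrM ler_nat leq_trunc_div.
(* x is half of the lower bound for the number of pairs; D was chosen so that
   the collisions cost at most the other half. *)
pose x : R := k%:R * (n%:R / (D * ln z%:R)).
have collisions_le : k%:R * k%:R * (n %/ z)%N%:R <= x.
  rewrite /x -mulrA; apply: ler_wpM2l; first exact: ltW.
  apply: le_trans (ler_wpM2l (ltW k_gt0) le_nz) _.
  rewrite mulrA ler_pdivrMr // mulrAC ler_pdivlMr ?mulr_gt0 //.
  have := ler_wpM2l (ltW n_gt0R) z_big; lra.
have main_ge : 2 * x <= k%:R * (#|` rough_upper_half z n|)%:R.
  have -> : 2 * x = k%:R * (c1 * (n%:R / ln z%:R)).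
    by rewrite /x c1_def; field; rewrite !gt_eqF.
  by apply: ler_wpM2l => //; exact: ltW.
apply: le_trans (_ : _ <= x) _; last by lra.
rewrite /x mulrC -!mulrA; apply: ler_wpM2l; first exact: ltW.
apply: ler_wpM2l; first exact: ltW.
rewrite -invfM lef_pV2 ?posrE ?mulr_gt0 //.
have : D * ln z%:R <= D * (C * ln k%:R) by apply: ler_wpM2l lnz; exact: ltW.
have : 0 <= N%:R ^+ 2 * ln k%:R := mulr_ge0 N2_ge0 (ltW lnk_gt0).
lra.
Qed.
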